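(* Let $U_N:\mathbb R^d\to(-\infty,\infty]$ and $K:\mathbb R^d\to\mathbb R$ be measurable, and put $\mathcal H_N(x,p)=U_N(x)+K(p)$ and $w_N(z)=\exp[-\mathcal H_N(z)]$ for $z=(x,p)\in\mathbb R^d\times\mathbb R^d$ (with $\exp(-\infty)=0$). Suppose $$0<\widetilde Z_N=\int_{\mathbb R^{2d}}w_N(z)\,dz<\infty,$$ that the proposal field $G_N:\mathbb R^d\to\mathbb R^d$ and the momentum velocity $v:\mathbb R^d\to\mathbb R^d$ are measurable and finite almost everywhere, and that $$K(-p)=K(p),\qquad v(-p)=-v(p).$$ Let $h>0$ and $L\in\mathbb N$, and let $\Psi_N=\mathcal R\circ\Phi_{N,h}^L$ be the $L$-step leapfrog proposal with momentum reversal built from $G_N$ and $v$ (defined in the context), with acceptance function $\alpha_N$ (defined in the context). Then the deterministic Metropolis kernel $$M_N(z,dz')=\alpha_N(z)\,\delta_{\Psi_Nz}(dz')+[1-\alpha_N(z)]\,\delta_z(dz')$$ is reversible with respect to the probability measure $\widetilde\pi_N(dz)=\widetilde Z_N^{-1}w_N(z)\,dz$. (No differentiability of $U_N$, $G_N$, $K$ or $v$ is required.)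
   Context: The kick and drift maps on $\mathbb R^d\times\mathbb R^d$ are $$\mathcal P_{N,h}(x,p)=(x,\,p-hG_N(x)),\qquad\mathcal Q_h(x,p)=(x+hv(p),\,p).$$ The one-step leapfrog map is $\Phi_{N,h}=\mathcal P_{N,h/2}\circ\mathcal Q_h\circ\mathcal P_{N,h/2}$, the momentum reversal is $\mathcal R(x,p)=(x,-p)$, and $\Psi_N=\mathcal R\circ\Phi_{N,h}^L$ where $\Phi_{N,h}^L$ is the $L$-fold composition. The acceptance function is $$\alpha_N(z)=\min\left\{1,\frac{w_N(\Psi_Nz)}{w_N(z)}\right\}\quad\text{if }w_N(z)>0,\qquad\alpha_N(z)=1\quad\text{if }w_N(z)=0.$$ Reversibility of $M_N$ with respect to $\widetilde\pi_N$ means $\widetilde\pi_N(dz)M_N(z,dz')=\widetilde\pi_N(dz')M_N(z',dz)$ as measures on the product space. *)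

(* Defs.v *)
From HB Require Import structures.
From mathcomp Require Import all_boot all_order all_algebra.
From mathcomp Require Import all_classical all_reals all_analysis.
From mathcomp Require Import measurable_realfun.

Set Implicit Arguments.
Unset Strict Implicit.
Unset Printing Implicit Defensive.

Import Order.TTheory GRing.Theory Num.Theory.
Import numFieldNormedType.Exports.

Local Open Scope classical_set_scope.
Local Open Scope ring_scope.

(* Row vectors carry the product sigma-algebra, the one generated by the
   coordinate maps; for entries in R this is the Borel sigma-algebra of R^n. *)
Section measurable_rV.
Context {d : measure_display} {T : measurableType d}.
Variable n : nat.

Let coords : 'I_n -> 'rV[T]_n -> T := fun i x => x ord0 i.

Let rV_set0 : g_sigma_preimage coords set0.
Proof. exact: sigma_algebra0. Qed.

Let rV_setC A : g_sigma_preimage coords A -> g_sigma_preimage coords (~` A).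
Proof. exact: sigma_algebraC. Qed.

Let rV_bigcup (F : (set 'rV[T]_n)^nat) :
  (forall i, g_sigma_preimage coords (F i)) ->
  g_sigma_preimage coords (\bigcup_i (F i)).
Proof. exact: sigma_algebra_bigcup. Qed.

HB.instance Definition _ := @isMeasurable.Build (measure_tuple_display d)
  'rV[T]_n (g_sigma_preimage coords) rV_set0 rV_setC rV_bigcup.

End measurable_rV.

Lemma measurable_coord d (T : measurableType d) n (i : 'I_n) :
  measurable_fun [set: 'rV[T]_n] (fun x : 'rV[T]_n => x ord0 i).
Proof.
move=> _ Y mY; rewrite setTI; apply: sub_sigma_algebra => /=.
rewrite -bigcup_seq/=; exists i => /=; first by rewrite mem_index_enum.
by exists Y => //; rewrite setTI.
Qed.

Lemma measurable_fun_rVP d1 d2 (T1 : measurableType d1)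
    (T2 : measurableType d2) n (f : T1 -> 'rV[T2]_n) :
  measurable_fun [set: T1] f <->
  forall i, measurable_fun [set: T1] (fun x => f x ord0 i).
Proof.
split=> [mf i|mf].
  exact: (measurableT_comp (measurable_coord i) mf).
move=> _ A; rewrite setTI => mA.
suff : g_sigma_preimage (fun i => (fun x : 'rV[T2]_n => x ord0 i) \o f)
    `<=` measurable.
  apply; rewrite g_sigma_preimage_comp; exists A => //.
  by rewrite setTI.
apply: smallest_sub; first exact: sigma_algebra_measurable.
case: n => [|n] in f mf A mA *; first by rewrite big_ord0.
rewrite -bigcup_mkord_ord; apply: bigcup_sub => i Ii.
by move=> B [C mC <-]; exact: mf.
Qed.

Definition rV_cons (R : realType) n (xy : R * 'rV[R]_n) : 'rV[R]_n.+1 :=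
  row_mx (const_mx xy.1 : 'rV_1) xy.2.

Lemma rV_cons0 (R : realType) n (xy : R * 'rV[R]_n) :
  rV_cons xy ord0 ord0 = xy.1.
Proof.
rewrite /rV_cons (_ : ord0 = lshift n (ord0 : 'I_1)); last exact/val_inj.
by rewrite (row_mxEl (const_mx xy.1 : 'rV_1)) mxE.
Qed.

Lemma rV_consS (R : realType) n (xy : R * 'rV[R]_n) (i : 'I_n) :
  rV_cons xy ord0 (lift ord0 i) = xy.2 ord0 i.
Proof.
rewrite /rV_cons (_ : lift ord0 i = rshift 1 i); last exact/val_inj.
by rewrite (row_mxEr (const_mx xy.1 : 'rV_1)).
Qed.

Lemma measurable_rV_cons (R : realType) n :
  measurable_fun [set: R * 'rV[R]_n] (@rV_cons R n).
Proof.
apply/measurable_fun_rVP => i; case: (unliftP ord0 i) => [j|] ->.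
- rewrite (_ : (fun _ => _) = (fun x : R * 'rV[R]_n => x.2 ord0 j)).
    exact: (measurableT_comp (measurable_coord j) measurable_snd).
  by apply/funext => x; rewrite rV_consS.
- rewrite (_ : (fun _ => _) = (@fst R 'rV[R]_n)); first exact: measurable_fst.
  by apply/funext => x; rewrite rV_cons0.
Qed.

Local Open Scope ereal_scope.

(* Lebesgue measure on R^n, the n-fold product of Lebesgue measures on R. *)
Fixpoint lebesgue_rV (R : realType) (n : nat) : set 'rV[R]_n -> \bar R :=
  if n is m.+1
  then pushforward (@lebesgue_measure R \x @lebesgue_rV R m) (@rV_cons R m)
  else \d_(0%R : 'rV[R]_0).


Section lebesgue_rV_measure.
Variable R : realType.

Let sigma_finite_measure_pushforward d1 d2 (T1 : measurableType d1)
    (T2 : measurableType d2) (m : {measure set T1 -> \bar R})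
    (f : T1 -> T2) (g : T2 -> T1) :
  sigma_finite setT m -> measurable_fun setT f -> measurable_fun setT g -> cancel f g ->
  [/\ pushforward m f set0 = 0, forall A, 0 <= pushforward m f A,
     semi_sigma_additive (pushforward m f) &
     sigma_finite setT (pushforward m f)].
Proof.
move=> [F FT Foo] mf mg fg; split.
- by rewrite /pushforward preimage_set0 measure0.
- by move=> A; exact: measure_ge0.
- move=> {FT Foo}F mF tF mUF; rewrite /pushforward preimage_bigcup.
  apply: measure_semi_sigma_additive.
  + by move=> n; rewrite -[X in measurable X]setTI; exact: mf.
  + apply/trivIsetP => /= i j _ _ ij; rewrite -preimage_setI.
    by move/trivIsetP : tF => /(_ _ _ _ _ ij) ->//; rewrite preimage_set0.
  + by rewrite -preimage_bigcup -[X in measurable X]setTI; exact: mf.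
- exists (fun n => g @^-1` F n).
    by rewrite -preimage_bigcup -FT preimage_setT.
  move=> n; have [mF mFoo] := Foo n; split.
    by rewrite -[X in measurable X]setTI; exact: mg.
  rewrite /pushforward (_ : _ @^-1` _ = F n)//.
  by apply/seteqP; split => x; rewrite /preimage/= fg.
Qed.

Let sigma_finite_product d1 d2 (T1 : measurableType d1)
    (T2 : measurableType d2) (m1 : {sigma_finite_measure set T1 -> \bar R})
    (m2 : {sigma_finite_measure set T2 -> \bar R}) :
  sigma_finite setT (m1 \x m2).
Proof.
have /sigma_finiteP[F [TF ndF Foo]] := sigma_finiteT m1.
have /sigma_finiteP[G [TG ndG Goo]] := sigma_finiteT m2.
exists (fun n => F n `*` G n).
  rewrite -setXTT TF TG predeqE => -[x y]; split.
    move=> [/= [n _ Fnx] [k _ Gky]]; exists (maxn n k) => //; split.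
    - by move: x Fnx; exact/subsetPset/ndF/leq_maxl.
    - by move: y Gky; exact/subsetPset/ndG/leq_maxr.
  by move=> [n _ []/= ? ?]; split; exists n.
move=> k; have [? ?] := Foo k; have [? ?] := Goo k.
split; first exact: measurableX.
by rewrite product_measure1E// lte_mul_pinfty// ge0_fin_numE.
Qed.

Let lebesgue_rV_sub n :
  [/\ @lebesgue_rV R n set0 = 0, forall A, 0 <= @lebesgue_rV R n A,
     semi_sigma_additive (@lebesgue_rV R n) &
     sigma_finite setT (@lebesgue_rV R n)].
Proof.
elim: n => [|n [m0 m_ge0 m_add m_sf]].
  by split=> /=; [exact: measure0|move=> A; exact: measure_ge0|
    exact: measure_semi_sigma_additive|exact: sigma_finiteT].
pose a := isMeasure.Build _ _ _ (@lebesgue_rV R n) m0 m_ge0 m_add.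
pose m : {measure set 'rV[R]_n -> \bar R} := HB.pack (@lebesgue_rV R n) a.
pose b := Measure_isSigmaFinite.Build _ _ _ m m_sf.
pose s : {sigma_finite_measure set 'rV[R]_n -> \bar R} :=
  HB.pack (@lebesgue_rV R n) a b.
pose l : {sigma_finite_measure set (measurableTypeR R) -> \bar R} :=
  @lebesgue_measure R.
pose p : {measure set _ -> \bar R} := (l \x s)%E.
pose g (x : 'rV[R]_n.+1) : (R * 'rV[R]_n)%type :=
  (x ord0 ord0, (\row_j x ord0 (lift ord0 j))%R).
apply: (@sigma_finite_measure_pushforward _ _ _ _ p _ g).
- exact: sigma_finite_product.
- exact: measurable_rV_cons.
- apply/measurable_fun_pairP; split; first exact: measurable_coord.
  apply/measurable_fun_rVP => j.
  rewrite (_ : (fun _ => _) = (fun x : 'rV[R]_n.+1 => x ord0 (lift ord0 j))).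
    exact: measurable_coord.
  by apply/funext => x /=; rewrite mxE.
- move=> [x y]; rewrite /g rV_cons0; congr pair.
  by apply/rowP => j; rewrite mxE rV_consS.
Qed.

HB.instance Definition _ n :=
  let: And4 m0 m_ge0 m_add _ := lebesgue_rV_sub n in
  isMeasure.Build _ _ _ (@lebesgue_rV R n) m0 m_ge0 m_add.

HB.instance Definition _ n :=
  let: And4 _ _ _ m_sf := lebesgue_rV_sub n in
  Measure_isSigmaFinite.Build _ _ _ (@lebesgue_rV R n) m_sf.

Lemma lebesgue_rV_box n (B : 'I_n -> set R) :
  (forall i, measurable (B i)) ->
  @lebesgue_rV R n [set x | forall i, B i (x ord0 i)] =
  \big[*%E/1%E]_(i < n) lebesgue_measure (B i).
Proof.
elim: n B => [|n IH] B mB.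
  by rewrite big_ord0 /= diracE mem_set// => -[].
rewrite big_ord_recl -(IH (fun i => B (lift ord0 i))) //.
rewrite /= /pushforward.
rewrite (_ : _ @^-1` _ = B ord0 `*`
  [set x : 'rV[R]_n | forall i, B (lift ord0 i) (x ord0 i)]); last first.
  apply/seteqP; split => [[x y] /= Bxy|[x y] /= [Bx By] i].
    by split=> [|i]; [have := Bxy ord0; rewrite rV_cons0|
      have := Bxy (lift ord0 i); rewrite rV_consS].
  by case: (unliftP ord0 i) => [j|] ->; rewrite ?rV_consS ?rV_cons0.
rewrite product_measure1E //; first exact: mB.
rewrite [X in measurable X](_ : _ = \bigcap_(i in [set: 'I_n])
    ((fun x : 'rV[R]_n => x ord0 i) @^-1` B (lift ord0 i))).
  apply: fin_bigcap_measurable => [|i _]; first exact: finite_finset.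
  by rewrite -[X in measurable X]setTI; exact: measurable_coord.
by apply/seteqP; split=> x /= Bx i; [move=> _; exact: Bx|exact: (Bx i)].
Qed.

End lebesgue_rV_measure.

(* The fields G and v may take infinite values on a null set, where the maps
   below read an infinite coordinate as 0 (this is the value of fine).  The
   choice only affects trajectories started from a null set of phase points.
   R^d-valued fields are the case in which all entries are finite. *)
Section leapfrog.
Local Open Scope ring_scope.
Context {R : realType} {d : nat}.
Implicit Types (G v : 'rV[R]_d -> 'rV[\bar R]_d) (z : 'rV[R]_d * 'rV[R]_d).

Definition kick (h : R) G z : 'rV[R]_d * 'rV[R]_d :=
  (z.1, z.2 - h *: map_mx fine (G z.1)).

Definition drift (h : R) v z : 'rV[R]_d * 'rV[R]_d :=
  (z.1 + h *: map_mx fine (v z.2), z.2).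

Definition leapfrog (h : R) G v : 'rV[R]_d * 'rV[R]_d -> 'rV[R]_d * 'rV[R]_d :=
  kick (h / 2) G \o drift h v \o kick (h / 2) G.

Definition momentum_reversal z : 'rV[R]_d * 'rV[R]_d := (z.1, - z.2).

Definition leapfrog_proposal (h : R) (L : nat) G v :
    'rV[R]_d * 'rV[R]_d -> 'rV[R]_d * 'rV[R]_d :=
  momentum_reversal \o iter L (leapfrog h G v).

End leapfrog.

Section metropolis.
Context {d : measure_display} {T : measurableType d} {R : realType}.
Implicit Types (w : T -> \bar R) (Psi : T -> T).

Definition acceptance w Psi (z : T) : \bar R :=
  if 0 < w z then Order.min 1 (w (Psi z) / w z) else 1.

Definition metropolis_kernel w Psi (z : T) (B : set T) : \bar R :=
  acceptance w Psi z * \d_(Psi z) B + (1 - acceptance w Psi z) * \d_z B.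

Definition normalized_density (mu : set T -> \bar R) w (A : set T) : \bar R :=
  (\int[mu]_z w z)^-1 * \int[mu]_(z in A) w z.

(* The two sides are the values at C of the measures pi(dz) M(z,dz') and
   pi(dz') M(z',dz) on the product space of pairs (z,z'). *)
Definition reversible (pi : set T -> \bar R) (M : T -> set T -> \bar R) :=
  forall C : set (T * T), measurable C ->
    \int[pi]_z M z (xsection C z) = \int[pi]_z M z (ysection C z).

End metropolis.

Section hamiltonian.
Context {R : realType} {d : nat}.
Implicit Types (U : 'rV[R]_d -> \bar R) (K : 'rV[R]_d -> R).

Definition hamiltonian U K (z : 'rV[R]_d * 'rV[R]_d) : \bar R :=
  U z.1 + (K z.2)%:E.

Definition weight U K (z : 'rV[R]_d * 'rV[R]_d) : \bar R :=
  expeR (- hamiltonian U K z).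

Definition lebesgue_phase : set ('rV[R]_d * 'rV[R]_d) -> \bar R :=
  @lebesgue_rV R d \x @lebesgue_rV R d.

End hamiltonian.

(* Main.v *)
Require Import Defs.
From HB Require Import structures.
From mathcomp Require Import all_boot all_order all_algebra.
From mathcomp Require Import all_classical all_reals all_analysis.
From mathcomp Require Import measurable_realfun.
Import Order.TTheory GRing.Theory Num.Theory.
Import numFieldNormedType.Exports.
Local Open Scope classical_set_scope.
Local Open Scope ring_scope.
Local Open Scope ereal_scope.

(** The kernel is a Metropolis kernel with a deterministic proposal [Psi], and
    such a kernel is reversible as soon as [Psi] is a measurable involution
    that preserves the reference measure [mu]. The diagonal part of the kernel
    contributes the same amount to both sides of detailed balance. For the
    moving part, [acceptance w Psi z * w z] equals the minimum of [w z] and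
    [w (Psi z)], which is invariant under exchanging [z] and [Psi z]; the
    change of variables [z = Psi z'] therefore turns the integral of this
    minimum over the event that (z, Psi z) lies in C into the integral over
    the event that (Psi z, z) lies in C. This is
    [metropolis_kernel_reversible]; it uses nothing about dynamics.

    It remains to see that the leapfrog proposal has the two properties. Kicks
    and drifts are shears: each moves one component by a translation that
    depends only on the other component. By Fubini, invariance of Lebesgue
    measure under translations is enough for a shear to preserve the product
    measure, so measurability of the fields suffices and no Jacobian is
    needed ([measure_preserving_leapfrog_proposal]). The momentum reversal
    conjugates a kick, and a drift with odd velocity, to its inverse; this
    passes to the palindromic composition kick-drift-kick and to its
    iterates, and makes the proposal an involution ([leapfrog_proposalK]).
    The involution property holds at every point: an infinite coordinate of a
    field is read as 0, and reading infinities as 0 commutes with negation. *)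

(** * Measure-preserving maps *)

Definition measure_preserving {d : measure_display} {T : measurableType d}
    {R : realType} (mu : set T -> \bar R) (f : T -> T) :=
  measurable_fun [set: T] f /\
  forall A, measurable A -> mu (f @^-1` A) = mu A.

Lemma measurable_preimageT {d1 d2} {T1 : measurableType d1}
    {T2 : measurableType d2} {f : T1 -> T2} {A : set T2} :
  measurable_fun [set: T1] f -> measurable A -> measurable (f @^-1` A).
Proof. by move=> mf mA; rewrite -[X in measurable X]setTI; exact: mf. Qed.

Lemma measure_preserving_id {d} {T : measurableType d} {R : realType}
    (mu : set T -> \bar R) : measure_preserving mu id.
Proof. by split=> //; exact: measurable_id. Qed.

Lemma measure_preserving_comp {d} {T : measurableType d} {R : realType}
    {mu : set T -> \bar R} {f g : T -> T} :
  measure_preserving mu f -> measure_preserving mu g ->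
  measure_preserving mu (f \o g).
Proof.
move=> [mf pf] [mg pg]; split; first exact: measurableT_comp.
move=> A mA; rewrite comp_preimage pg ?pf//.
exact: measurable_preimageT.
Qed.

Lemma measure_preserving_iter {d} {T : measurableType d} {R : realType}
    {mu : set T -> \bar R} {f : T -> T} n :
  measure_preserving mu f -> measure_preserving mu (iter n f).
Proof.
move=> pf; elim: n => [|n IH]; first exact: measure_preserving_id.
exact: (measure_preserving_comp pf IH).
Qed.

Lemma ge0_integral_measure_preserving {d} {T : measurableType d} {R : realType}
    {mu : {measure set T -> \bar R}} {f : T -> T} {g : T -> \bar R} :
  measure_preserving mu f -> measurable_fun [set: T] g ->
  (forall x, 0 <= g x) -> \int[mu]_x g (f x) = \int[mu]_x g x.
Proof.
move=> [mf pf] mg g0.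
rewrite -[LHS](@ge0_integral_pushforward _ _ _ _ _ f mf mu setT g)//.
by apply: eq_measure_integral => //= A mA _; exact: pf.
Qed.

(** * Shears of a product space *)

Section shear.
Context {d1 d2 : measure_display} {T1 : measurableType d1}
  {T2 : measurableType d2} {R : realType}.
Variables (m1 : {sigma_finite_measure set T1 -> \bar R})
  (m2 : {sigma_finite_measure set T2 -> \bar R}).

(** The section at [x] of the preimage of [A] is the preimage under [t x] of
    the section of [A], and the product measure integrates the measures of
    the sections. *)
Lemma measure_preserving_shear2 (t : T1 -> T2 -> T2) :
  measurable_fun setT (fun z : T1 * T2 => (z.1, t z.1 z.2)) ->
  (forall x, measure_preserving m2 (t x)) ->
  measure_preserving (m1 \x m2) (fun z => (z.1, t z.1 z.2)).
Proof.
move=> mt pt; split=> // A mA.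
apply: eq_integral => x _ /=.
rewrite -[RHS](pt x).2; last exact: measurable_xsection.
by congr (m2 _); apply/seteqP; split => y; rewrite /xsection /= !inE.
Qed.

(** Here the sections have to be taken along the second factor, so the iterated
    integral is first rewritten in the other order. *)
Lemma measure_preserving_shear1 (t : T2 -> T1 -> T1) :
  measurable_fun setT (fun z : T1 * T2 => (t z.2 z.1, z.2)) ->
  (forall y, measure_preserving m1 (t y)) ->
  measure_preserving (m1 \x m2) (fun z => (t z.2 z.1, z.2)).
Proof.
move=> mt pt; split=> // A mA.
have m12 : forall B, measurable B -> (m1 \x m2) B = (m1 \x^ m2) B.
  by apply: product_measure_unique => //= ? ? ? ?; rewrite product_measure2E.
rewrite !m12//; last exact: measurable_preimageT.
apply: eq_integral => y _ /=.
rewrite -[RHS](pt y).2; last exact: measurable_ysection.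
by congr (m1 _); apply/seteqP; split => x; rewrite /ysection /= !inE.
Qed.

(** A product map is the composition of two shears whose moving part ignores
    the other component. *)
Lemma measure_preserving_prod (f : T1 -> T1) (g : T2 -> T2) :
  measure_preserving m1 f -> measure_preserving m2 g ->
  measure_preserving (m1 \x m2) (fun z => (f z.1, g z.2)).
Proof.
move=> pf pg.
apply: (@measure_preserving_comp _ _ _ _
  (fun z => (f z.1, z.2)) (fun z => (z.1, g z.2))).
- apply: (@measure_preserving_shear1 (fun=> f)) => //.
  apply: measurable_fun_pair; last exact: measurable_snd.
  exact: (measurableT_comp pf.1 measurable_fst).
- apply: (@measure_preserving_shear2 (fun=> g)) => //.
  apply: measurable_fun_pair; first exact: measurable_fst.
  exact: (measurableT_comp pg.1 measurable_snd).
Qed.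
End shear.

(** * Translations and reflections of Lebesgue measure *)

Lemma measure_preserving_addr_lebesgue (R : realType) (a : R) :
  measure_preserving (@lebesgue_measure R) (fun x => (x + a)%R).
Proof.
pose t : measurableTypeR R -> measurableTypeR R := fun x => (x + a)%R.
have mt : measurable_fun [set: measurableTypeR R] t.
  by apply: measurable_funD => //; exact: measurable_id.
split => // A mA; apply/esym.
(* Two measures that agree on the intervals ]b, c] are equal. *)
apply: (@lebesgue_measure_unique R (pushforward lebesgue_measure t)) => //.
move=> _ [[b c]] _ <-.
have bca : t @^-1` `]b, c] = `](b - a)%R, (c - a)%R]%classic.
  by apply/seteqP; split=> x; rewrite /= !in_itv/= ltrBlDr lerBrDr.
rewrite /= /pushforward bca !lebesgue_measure_itv/= !lte_fin ltrD2r.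
by rewrite -!EFinB opprB addrA subrK.
Qed.

Lemma measure_preserving_oppr_lebesgue (R : realType) :
  measure_preserving (@lebesgue_measure R) (fun x => (- x)%R).
Proof.
split; last by move=> A mA; exact: lebesgue_measureN.
by apply: measurable_funN; exact: measurable_id.
Qed.

(** Lebesgue measure in dimension [n.+1] is the image of a product under
    [rV_cons], and a coordinatewise map corresponds under [rV_cons] to a
    product map. *)
Lemma measure_preserving_coordinatewise (R : realType) n (f : 'I_n -> R -> R) :
  (forall i, measure_preserving (@lebesgue_measure R) (f i)) ->
  measure_preserving (@lebesgue_rV R n) (fun x => \row_i f i (x ord0 i))%R.
Proof.
elim: n f => [|n IH] f pf; split.
- by apply/measurable_fun_rVP => -[].
- move=> A mA; rewrite (_ : (fun x : 'rV[R]_0 => _) = id)//.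
  by apply/funext => x; rewrite (thinmx0 x) [LHS]thinmx0.
- apply/measurable_fun_rVP => i.
  apply: (eq_measurable_fun (fun x : 'rV[R]_n.+1 => f i (x ord0 i))).
    by move=> x _; rewrite mxE.
  exact: (measurableT_comp (pf i).1 (measurable_coord i)).
- move=> A mA /=; rewrite /pushforward.
  have mB : measurable (@rV_cons R n @^-1` A).
    exact: measurable_preimageT (@measurable_rV_cons R n) mA.
  pose fg (z : R * 'rV[R]_n) : R * 'rV[R]_n :=
    (f ord0 z.1, (\row_i f (lift ord0 i) (z.2 ord0 i))%R).
  have [_ /(_ _ mB) <-] :
      measure_preserving (lebesgue_measure \x @lebesgue_rV R n) fg.
    exact: (measure_preserving_prod _ _ _ _ (pf ord0)
      (IH _ (fun i => pf (lift ord0 i)))).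
  apply: congr1; apply/funext => z; apply: (congr1 A).
  apply/rowP => i; rewrite mxE.
  by case: (unliftP ord0 i) => [j|] ->; rewrite ?rV_consS ?rV_cons0 ?mxE.
Qed.

Lemma measure_preserving_translation (R : realType) n (a : 'rV[R]_n) :
  measure_preserving (@lebesgue_rV R n) (fun x => (x + a)%R).
Proof.
have -> : (fun x => (x + a)%R) =
    (fun x : 'rV[R]_n => \row_i (x ord0 i + a ord0 i))%R.
  by apply/funext => x; apply/rowP => i; rewrite !mxE.
apply: (measure_preserving_coordinatewise _ _ (fun i y => (y + a ord0 i)%R)).
by move=> i; exact: measure_preserving_addr_lebesgue.
Qed.

Lemma measure_preserving_opp (R : realType) n :
  measure_preserving (@lebesgue_rV R n) (fun x => (- x)%R).
Proof.
have -> : (fun x => (- x)%R) = (fun x : 'rV[R]_n => \row_i (- x ord0 i))%R.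
  by apply/funext => x; apply/rowP => i; rewrite !mxE.
apply: (measure_preserving_coordinatewise _ _ (fun _ y => (- y)%R)) => i.
exact: measure_preserving_oppr_lebesgue.
Qed.

(** * The leapfrog proposal *)

Section leapfrog.
Context {R : realType} {d : nat}.
Implicit Types (G v : 'rV[R]_d -> 'rV[\bar R]_d) (z : 'rV[R]_d * 'rV[R]_d).

Lemma measurable_scale_fine (h : R) G : measurable_fun [set: 'rV[R]_d] G ->
  measurable_fun [set: 'rV[R]_d] (fun x => h *: map_mx fine (G x))%R.
Proof.
move=> mG; apply/measurable_fun_rVP => i.
apply: (eq_measurable_fun (fun x => h * fine (G x ord0 i))%R).
  by move=> x _; rewrite !mxE.
apply: measurable_funM => //.
apply: (measurableT_comp _ (measurableT_comp (measurable_coord i) mG)).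
exact: fine_measurable.
Qed.

Lemma measurable_fun_rVD d1 (T : measurableType d1) (f g : T -> 'rV[R]_d) :
  measurable_fun setT f -> measurable_fun setT g ->
  measurable_fun setT (fun x => f x + g x)%R.
Proof.
move=> mf mg; apply/measurable_fun_rVP => i.
apply: (eq_measurable_fun (fun x => f x ord0 i + g x ord0 i)%R).
  by move=> x _; rewrite !mxE.
by apply: measurable_funD; exact: (measurableT_comp (measurable_coord i)).
Qed.

Lemma measure_preserving_kick h G : measurable_fun [set: 'rV[R]_d] G ->
  measure_preserving (@lebesgue_phase R d) (kick h G).
Proof.
move=> mG; apply: (measure_preserving_shear2
  (@lebesgue_rV R d) (@lebesgue_rV R d)
  (fun x p => p - h *: map_mx fine (G x))%R).
- apply: measurable_fun_pair; first exact: measurable_fst.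
  apply: measurable_fun_rVD; first exact: measurable_snd.
  apply: (measurableT_comp (measure_preserving_opp R d).1).
  exact: (measurableT_comp (measurable_scale_fine h G mG) measurable_fst).
- by move=> x; exact: measure_preserving_translation.
Qed.

Lemma measure_preserving_drift h v : measurable_fun [set: 'rV[R]_d] v ->
  measure_preserving (@lebesgue_phase R d) (drift h v).
Proof.
move=> mv; apply: (measure_preserving_shear1
  (@lebesgue_rV R d) (@lebesgue_rV R d)
  (fun p x => x + h *: map_mx fine (v p))%R).
- apply: measurable_fun_pair; last exact: measurable_snd.
  apply: measurable_fun_rVD; first exact: measurable_fst.
  exact: (measurableT_comp (measurable_scale_fine h v mv) measurable_snd).
- by move=> x; exact: measure_preserving_translation.
Qed.

Lemma measure_preserving_leapfrog_proposal h L G v :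
  measurable_fun [set: 'rV[R]_d] G -> measurable_fun [set: 'rV[R]_d] v ->
  measure_preserving (@lebesgue_phase R d) (leapfrog_proposal h L G v).
Proof.
move=> mG mv; apply: measure_preserving_comp.
  exact: (measure_preserving_prod (@lebesgue_rV R d) (@lebesgue_rV R d) id _
    (measure_preserving_id _) (measure_preserving_opp R d)).
have pk := measure_preserving_kick (h / 2) G mG.
apply/measure_preserving_iter/(measure_preserving_comp _ pk).
exact: (measure_preserving_comp pk (measure_preserving_drift h v mv)).
Qed.

Lemma momentum_reversalK : involutive (@momentum_reversal R d).
Proof. by case=> x p; rewrite /momentum_reversal /= opprK. Qed.

(** The reversed momentum makes the second kick undo the first one, which acts
    with the same force since the position has not moved. *)
Lemma kick_reversible h G z :
  kick h G (momentum_reversal (kick h G z)) = momentum_reversal z.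
Proof.
case: z => x p; rewrite /kick /momentum_reversal/=.
by rewrite opprB addrAC subrr add0r.
Qed.

(** The second drift runs with velocity [v (- p)], which cancels the first;
    this survives [fine] because [fine] is odd, also at infinite values. *)
Lemma drift_reversible h v z : (forall p i, v (- p)%R ord0 i = - v p ord0 i) ->
  drift h v (momentum_reversal (drift h v z)) = momentum_reversal z.
Proof.
move=> v_odd; case: z => x p; rewrite /drift /momentum_reversal/=.
congr pair; rewrite -addrA -scalerDr.
rewrite (_ : map_mx _ _ + _ = 0)%R ?scaler0 ?addr0//.
by apply/rowP => i; rewrite !mxE v_odd fineN subrr.
Qed.

(** If a map [f] satisfies [f (r (f z)) = r z], for the reversal [r], then so
    do the palindromes [g \o f \o g] built from such maps, and the iterates
    of [f]. *)
Lemma leapfrog_proposalK h L G v :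
  (forall p i, v (- p)%R ord0 i = - v p ord0 i) ->
  involutive (leapfrog_proposal h L G v).
Proof.
move=> v_odd z; rewrite /leapfrog_proposal /=.
suff -> : iter L (leapfrog h G v)
    (momentum_reversal (iter L (leapfrog h G v) z)) = momentum_reversal z.
  exact: momentum_reversalK.
(* One step is peeled off next to the reversal, the other ones outside. *)
elim: L z => [//|L IH] z; rewrite iterSr iterS -[RHS]IH.
by rewrite /leapfrog /= kick_reversible drift_reversible// kick_reversible.
Qed.

End leapfrog.

(** * Integration against a density *)

Section density.
Import HBNNSimple.

(** Both sides are continuous along an increasing sequence of simple functions
    tending to [f], and linear in simple functions; for an indicator function
    the equality is the hypothesis on [nu]. Finiteness of [g] makes the
    products with the approximations converge pointwise. *)
Lemma ge0_integral_density {d} {T : measurableType d} {R : realType}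
    (mu nu : {measure set T -> \bar R}) (g f : T -> \bar R) :
  measurable_fun [set: T] g -> (forall x, 0 <= g x) ->
  (forall x, g x \is a fin_num) ->
  (forall A, measurable A -> nu A = \int[mu]_(x in A) g x) ->
  measurable_fun [set: T] f -> (forall x, 0 <= f x) ->
  \int[nu]_x f x = \int[mu]_x (f x * g x).
Proof.
move=> mg g0 gfin nug mf f0; pose h := nnsfun_approx measurableT mf.
have mh n : measurable_fun [set: T] (fun x => (h n x)%:E).
  exact/measurable_EFinP.
have hf x : (h n x)%:E @[n --> \oo] --> f x by exact: cvg_nnsfun_approx.
have hnd x : {homo (fun n => (h n x)%:E) : m n / (m <= n)%N >-> m <= n}.
  by move=> m n mn; rewrite lee_fin; exact/lefP/nd_nnsfun_approx.
have -> : \int[nu]_x f x = limn (fun n => \int[nu]_x (h n x)%:E).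
  rewrite -monotone_convergence//; last by move=> n x _; rewrite lee_fin.
  by apply: eq_integral => x _; apply/esym/cvg_lim.
have -> : \int[mu]_x (f x * g x) =
    limn (fun n => \int[mu]_x ((h n x)%:E * g x)).
  rewrite -monotone_convergence//.
  - apply: eq_integral => x _; apply/esym/cvg_lim => //.
    by apply: cvgeZr => //; exact: hf.
  - by move=> n; exact: emeasurable_funM.
  - by move=> n x _; rewrite mule_ge0// lee_fin.
  - by move=> x _ m n mn; rewrite lee_wpmul2r//; exact: hnd.
congr (limn _); apply/funext => n.
pose A r := h n @^-1` [set r].
have mA r : measurable (A r) by exact: measurable_sfunP.
have hE x : (h n x)%:E = \sum_(r \in range (h n)) (r * \1_(A r) x)%:E.
  by rewrite fsumEFin// -fimfunE.
have m1 r : measurable_fun [set: T] (fun x => (\1_(A r) x)%:E : \bar R).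
  exact/measurable_EFinP/measurable_indic.
have mr r : measurable_fun [set: T] (fun x => (r * \1_(A r) x)%:E).
  by apply/measurable_EFinP/measurable_funM => //; exact/measurable_EFinP.
have term_ge0 r x : 0 <= (r * \1_(A r) x)%:E by exact: nnfun_muleindic_ge0.
under eq_integral do rewrite hE.
under [RHS]eq_integral do rewrite hE ge0_mule_fsuml//.
rewrite !ge0_integral_fsum//.
- apply: eq_fsbigr => r rh.
  have r0 : (0 <= r)%R by move: rh; rewrite inE => -[x _ <-].
  under eq_integral do rewrite EFinM.
  under [RHS]eq_integral do rewrite EFinM -muleA.
  rewrite !ge0_integralZl//.
  + rewrite integral_indic// setIT nug//; congr (_ * _).
    rewrite integral_mkcond; apply: eq_integral => x _.
    by rewrite epatch_indic muleC.
  + exact: emeasurable_funM.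
  + by move=> x _; rewrite mule_ge0// lee_fin.
- by move=> r; exact: emeasurable_funM.
- by move=> r x _; rewrite mule_ge0.
Qed.

End density.

(** * Metropolis kernels with a deterministic proposal *)

Section metropolis.
Context {d : measure_display} {T : measurableType d} {R : realType}.
Variables (mu : {measure set T -> \bar R}) (w : T -> \bar R).
Hypotheses (mw : measurable_fun [set: T] w) (w_ge0 : forall z, 0 <= w z)
  (w_fin : forall z, w z < +oo) (Z_gt0 : 0 < \int[mu]_z w z).

Let c := (\int[mu]_z w z)^-1.

Let c_ge0 : 0 <= c.
Proof. by rewrite /c inve_ge0 ltW. Qed.

Let c_fin : c \is a fin_num.
Proof. by rewrite ge0_fin_numE// ltey inve_eqy gt_eqF. Qed.

Lemma normalized_densityE A : measurable A ->
  normalized_density mu w A = \int[mu]_(z in A) (c * w z).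
Proof. by move=> mA; rewrite ge0_integralZl//; exact: measurable_funTS. Qed.

Let normalized_density0 : normalized_density mu w set0 = 0.
Proof. by rewrite normalized_densityE// integral_set0. Qed.

Let normalized_density_ge0 A : 0 <= normalized_density mu w A.
Proof. by rewrite mule_ge0// integral_ge0. Qed.

Let normalized_density_semi_sigma_additive :
  semi_sigma_additive (normalized_density mu w).
Proof.
move=> F mF tF mUF; rewrite normalized_densityE//.
rewrite ge0_integral_bigcup//; last 2 first.
- by apply: measurable_funTS; exact: emeasurable_funM.
- by move=> x _; rewrite mule_ge0.
under eq_fun do under eq_bigr do rewrite normalized_densityE//.
apply: is_cvg_nneseries => n _ _; apply: integral_ge0 => x _.
by rewrite mule_ge0.
Qed.

(** [normalized_density mu w] is only a function on sets; it is made into a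
    measure here so that the change to the reference measure applies. *)
Lemma integral_normalized_density (f : T -> \bar R) :
  measurable_fun [set: T] f -> (forall z, 0 <= f z) ->
  \int[normalized_density mu w]_z f z = \int[mu]_z (f z * (c * w z)).
Proof.
pose a := isMeasure.Build _ _ _ (normalized_density mu w)
  normalized_density0 normalized_density_ge0
  normalized_density_semi_sigma_additive.
pose m : {measure set T -> \bar R} := HB.pack (normalized_density mu w) a.
apply: (ge0_integral_density mu m); first exact: emeasurable_funM.
- by move=> z; rewrite mule_ge0.
- by move=> z; rewrite fin_numM// ge0_fin_numE.
- exact: normalized_densityE.
Qed.

Variable Psi : T -> T.
Hypotheses (Psi_inv : involutive Psi) (Psi_mp : measure_preserving mu Psi).
Let mPsi : measurable_fun [set: T] Psi := Psi_mp.1.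

Lemma acceptance_ge0 z : 0 <= acceptance w Psi z.
Proof.
rewrite /acceptance; case: ifP => // wz.
by rewrite le_min lee01 mule_ge0// inve_ge0.
Qed.

Lemma acceptance_le1 z : acceptance w Psi z <= 1.
Proof. by rewrite /acceptance; case: ifP => // wz; rewrite ge_min lexx. Qed.

Lemma measurable_acceptance : measurable_fun [set: T] (acceptance w Psi).
Proof.
have mwPsi := measurableT_comp mw mPsi.
(* The inverse of a positive real is its power with exponent -1, and powers
   are measurable. *)
apply: (eq_measurable_fun (fun z => if 0 < w z then
    mine 1 (w (Psi z) * ((fine (w z)) `^ (-1))%:E) else 1)).
  move=> z _; rewrite /acceptance; case: ifPn => // wz.
  rewrite powR_inv1 ?fine_ge0// -[in RHS](@fineK _ (w z)) ?ge0_fin_numE//.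
  by rewrite inver gt_eqF// fine_gt0// wz w_fin.
apply: measurable_fun_ifT => //; first exact: measurable_fun_lte.
apply: measurable_mine => //; apply: emeasurable_funM => //.
apply/measurable_EFinP.
have mfine : measurable_fun [set: \bar R] fine by exact: fine_measurable.
exact: (measurableT_comp (measurable_powR (-1)%R) (measurableT_comp mfine mw)).
Qed.

(** The symmetry in [z] and [Psi z] that detailed balance rests on. *)
Lemma weight_acceptance z : acceptance w Psi z * w z = mine (w z) (w (Psi z)).
Proof.
rewrite /acceptance; case: ifPn => [wz|]; last first.
  rewrite -leNgt => wz; have -> : w z = 0 by apply/le_anti; rewrite wz w_ge0.
  by rewrite mule0 min_l.
have wzfin : w z \is a fin_num by rewrite ge0_fin_numE.
by rewrite mine_pMl// mul1e -muleA (muleC _ (w z)) divee ?mule1// gt_eqF.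
Qed.

(** The flow out of [z] splits into the part that jumps to [Psi z] and the part
    that stays at [z]. *)
Lemma integral_metropolis_kernel (B : T -> set T) :
  measurable_fun [set: T] (fun z => \d_(Psi z) (B z) : \bar R) ->
  measurable_fun [set: T] (fun z => \d_z (B z) : \bar R) ->
  \int[normalized_density mu w]_z metropolis_kernel w Psi z (B z) =
  \int[mu]_z (c * mine (w z) (w (Psi z)) * \d_(Psi z) (B z)) +
  \int[mu]_z ((1 - acceptance w Psi z) * \d_z (B z) * (c * w z)).
Proof.
move=> mB1 mB2; have ma := measurable_acceptance.
have m1a : measurable_fun setT (fun z => 1 - acceptance w Psi z).
  by apply: emeasurable_funB.
have a1_ge0 z : 0 <= 1 - acceptance w Psi z.
  by rewrite subre_ge0 ?acceptance_le1.
rewrite (integral_normalized_density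
  (fun z => metropolis_kernel w Psi z (B z))); last 2 first.
- by apply: emeasurable_funD; exact: emeasurable_funM.
- by move=> z; rewrite adde_ge0// mule_ge0// acceptance_ge0.
rewrite -ge0_integralD//; last 4 first.
- by move=> z _; rewrite !mule_ge0// le_min !w_ge0.
- apply: emeasurable_funM => //; apply: emeasurable_funM => //.
  by apply: measurable_mine => //; exact: measurableT_comp.
- by move=> z _; rewrite !mule_ge0.
- by repeat apply: emeasurable_funM => //.
apply: eq_integral => z _; rewrite ge0_muleDl ?mule_ge0 ?acceptance_ge0//.
by congr (_ + _); rewrite -weight_acceptance muleAC muleCA.
Qed.

(** The jump terms are exchanged by the substitution of [Psi z] for [z]. The
    terms that stay agree by conversion: both sections of [C] at [z] contain
    [z] exactly when (z, z) is in [C]. *)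
Theorem metropolis_kernel_reversible :
  reversible (normalized_density mu w) (metropolis_kernel w Psi).
Proof.
move=> C mC.
have dE (g1 g2 : T -> T) : measurable_fun setT g1 -> measurable_fun setT g2 ->
    measurable_fun setT (fun z => (\1_C (g1 z, g2 z))%:E : \bar R).
  move=> mg1 mg2; apply/measurable_EFinP.
  exact: (measurableT_comp (@measurable_indic _ _ _ setT _ mC)
    (measurable_fun_pair mg1 mg2)).
have id_m : measurable_fun setT (@id T) by exact: measurable_id.
have dx z y : \d_y (xsection C z) = (\1_C (z, y))%:E :> \bar R.
  by rewrite diracE indicE mem_xsection.
have dy z y : \d_y (ysection C z) = (\1_C (y, z))%:E :> \bar R.
  by rewrite diracE indicE mem_ysection.
rewrite !integral_metropolis_kernel; first congr (_ + _).
- under [LHS]eq_integral do rewrite dx.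
  under [RHS]eq_integral do rewrite dy.
  pose F z := c * mine (w z) (w (Psi z)) * (\1_C (Psi z, z))%:E.
  rewrite -[RHS](@ge0_integral_measure_preserving _ _ _ _ _ F Psi_mp)//.
  + by apply: eq_integral => z _; rewrite /F Psi_inv minC.
  + apply: emeasurable_funM; last exact: dE.
    apply: emeasurable_funM => //; apply: measurable_mine => //.
    exact: measurableT_comp.
  + by move=> z; rewrite !mule_ge0// ?le_min ?w_ge0// lee_fin.
- by under eq_fun do rewrite dy; exact: dE.
- by under eq_fun do rewrite dy; exact: dE.
- by under eq_fun do rewrite dx; exact: dE.
- by under eq_fun do rewrite dx; exact: dE.
Qed.

End metropolis.

(** * The Hamiltonian weight *)

(** [er_map expR] fixes both infinities, and the maximum with 0 corrects the
    value at [-oo]. *)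
Lemma measurable_expeR (R : realType) : measurable_fun [set: \bar R] (@expeR R).
Proof.
rewrite (_ : @expeR R = fun x => maxe (er_map expR x) 0).
  apply: measurable_maxe => //.
  exact: (measurable_er_map (measurableTypeR R) (@measurable_expR R)).
apply/funext => -[r| |] /=; [|by rewrite max_l..|by rewrite max_r].
by rewrite max_l// lee_fin expR_ge0.
Qed.

Lemma measurable_weight (R : realType) (d : nat) (U : 'rV[R]_d -> \bar R)
    (K : 'rV[R]_d -> R) :
  measurable_fun setT U -> measurable_fun setT K ->
  measurable_fun setT (weight U K).
Proof.
move=> mU mK; apply: (measurableT_comp (measurable_expeR R)).
apply: measurableT_comp => //.
apply: emeasurable_funD; first exact: (measurableT_comp mU measurable_fst).
by apply/measurable_EFinP; exact: (measurableT_comp mK measurable_snd).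
Qed.

Theorem theorem3p1 (R : realType) (d : nat)
    (U : 'rV[R]_d -> \bar R) (K : 'rV[R]_d -> R)
    (G v : 'rV[R]_d -> 'rV[\bar R]_d) (h : R) (L : nat)
    (U_gtNy : forall x, -oo < U x)
    (mU : measurable_fun [set: 'rV[R]_d] U)
    (mK : measurable_fun [set: 'rV[R]_d] K)
    (Z_gt0 : 0 < \int[lebesgue_phase]_z weight U K z)
    (Z_fin : \int[lebesgue_phase]_z weight U K z < +oo)
    (mG : measurable_fun [set: 'rV[R]_d] G)
    (mv : measurable_fun [set: 'rV[R]_d] v)
    (G_fin : {ae @lebesgue_rV R d, forall x i, G x ord0 i \is a fin_num})
    (v_fin : {ae @lebesgue_rV R d, forall p i, v p ord0 i \is a fin_num})
    (K_even : forall p, K (- p)%R = K p)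
    (v_odd : forall p i, v (- p)%R ord0 i = - v p ord0 i)
    (h_gt0 : (0 < h)%R) :
  reversible (normalized_density lebesgue_phase (weight U K))
    (metropolis_kernel (weight U K) (leapfrog_proposal h L G v)).
Proof.
have w_fin z : weight U K z < +oo.
  have := U_gtNy z.1; rewrite /weight /hamiltonian.
  by case: (U z.1) => //= r _; rewrite ltry.
exact: (metropolis_kernel_reversible (@lebesgue_rV R d \x @lebesgue_rV R d)
  (weight U K) (measurable_weight _ _ U K mU mK) (fun=> expeR_ge0 _) w_fin
  Z_gt0 (leapfrog_proposal h L G v)
  (leapfrog_proposalK h L G v v_odd)
  (measure_preserving_leapfrog_proposal h L G v mG mv)).
Qed.
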